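(* Let $n,r,e,R$ be integers with $e\ge 2$, and for integers $R,e$ let $T_r(n,R,e):=f_r(n,er-R,e)$. Then for every integer $l$ with $1\le l\le r$, $$T_r(n,R,e)\le T_r(n,R-l,e-1)+\binom{n}{l}\Big/\binom{r}{l}.$$
   Context: For integers $r,v,e$, an $r$-uniform hypergraph is called $\mathcal{G}_r(v,e)$-free if the union of any $e$ distinct edges has at least $v+1$ vertices. $f_r(n,v,e)$ denotes the maximum number of edges in a $\mathcal{G}_r(v,e)$-free $r$-uniform hypergraph on $n$ vertices. *)

(* Defs.v *)
From mathcomp Require Import all_boot all_order all_algebra.

Set Implicit Arguments.
Unset Strict Implicit.
Unset Printing Implicit Defensive.

Import Order.TTheory GRing.Theory Num.Theory.

Local Open Scope ring_scope.

(* A hypergraph on the vertex set V is a set H : {set {set V}} of edges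
   (no multiple edges). *)
Definition uniform_hypergraph (V : finType) (r : nat) (H : {set {set V}}) : bool :=
  [forall A in H, #|A| == r].

(* v ranges over all integers, as it is instantiated below with e * r - R, which
   may be negative; in that case every hypergraph is free. *)
Definition Gfree (V : finType) (v : int) (e : nat) (H : {set {set V}}) : bool :=
  [forall S : {set {set V}},
     (S \subset H) && (#|S| == e) ==> (v + 1 <= #|cover S|%:Z)].

(* For e >= 1 the maximum is over a nonempty family, since set0 qualifies. *)
Definition fmax (r n : nat) (v : int) (e : nat) : nat :=
  \max_(H : {set {set 'I_n}} | uniform_hypergraph r H && Gfree v e H) #|H|.

Definition Tmax (r n : nat) (R : int) (e : nat) : nat :=
  fmax r n (e%:Z * r%:Z - R) e.

(* Main.v *)
(* Take a maximal subfamily M of H whose members pairwise share fewer than l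
   vertices: each l-set lies in at most one member, so |M| 'C(r, l) <= 'C(n, l).
   By maximality every edge of H outside M shares at least l vertices with some
   edge of M; adding that edge to e - 1 edges of H :\: M adds at most r - l
   vertices, so freeness of H for e edges yields freeness of H :\: M for e - 1. *)
Require Import Defs.
From mathcomp Require Import all_boot all_order all_algebra.
From mathcomp Require Import zify.

Set Implicit Arguments.
Unset Strict Implicit.
Unset Printing Implicit Defensive.

Import Order.TTheory GRing.Theory Num.Theory.

Local Open Scope ring_scope.

(** On an [r]-uniform family this is a partial Steiner system: no [l]-set lies in two members. *)
Definition partial_packing (V : finType) (l : nat) (M : {set {set V}}) : bool :=
  [forall A in M, forall B in M, (A != B) ==> (#|A :&: B| < l)%N].

Lemma partial_packingP (V : finType) (l : nat) (M : {set {set V}}) :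
  reflect {in M &, forall A B, A != B -> (#|A :&: B| < l)%N}
          (partial_packing l M).
Proof.
apply: (iffP forall_inP) => [pM A B AM BM|pM A AM].
  by move/forall_inP: (pM A AM) => /(_ B BM) /implyP.
by apply/forall_inP => B BM; apply/implyP; apply: pM.
Qed.

Lemma partial_packing_card (V : finType) (r l : nat) (M : {set {set V}}) :
  uniform_hypergraph r M -> partial_packing l M ->
  (#|M| * 'C(r, l) <= 'C(#|V|, l))%N.
Proof.
move=> /forall_inP unif /partial_packingP packM.
rewrite -sum_nat_const -card_draws -sum1_card.
have draws A : A \in M ->
    'C(r, l) = (\sum_(L : {set V} | (L \subset A) && (#|L| == l)) 1)%N.
  by move=> AM; rewrite -(eqP (unif A AM)) -cards_draws -sum1dep_card.
rewrite (eq_bigr _ draws).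
(* Double counting of the pairs of a member [A] and an [l]-subset [L] of it; after the exchange each
   [L] has to contribute at most 1. *)
rewrite (exchange_big_dep (fun L : {set V} => #|L| == l)) /=; last first.
  by move=> A L _ /andP[].
rewrite [leqRHS](eq_bigl (fun L : {set V} => #|L| == l)); last first.
  by move=> L; rewrite inE.
apply: leq_sum => L /eqP cardL.
rewrite sum1dep_card; apply/card_le1P => A.
rewrite inE => /and3P[AM LA _] B; rewrite !inE.
apply/idP/eqP => [/and3P[BM LB _]|->]; last by rewrite AM LA cardL eqxx.
apply/eqP/negPn/negP => BA.
have := packM B A BM AM BA.
by rewrite ltnNge -cardL subset_leq_card // subsetI LB.
Qed.

Lemma partial_packing_maximal (V : finType) (l : nat) (H : {set {set V}}) :
  exists2 M : {set {set V}}, (M \subset H) && partial_packing l M &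
    forall A, A \in H :\: M -> exists2 B, B \in M & (l <= #|A :&: B|)%N.
Proof.
pose P (M : {set {set V}}) := (M \subset H) && partial_packing l M.
have P0 : P set0.
  by rewrite /P sub0set; apply/partial_packingP => A B; rewrite inE.
have [M /maxsetP[PM maxM] _] := maxset_exists P0.
exists M => // A /setDP[AH AM].
have [MH /partial_packingP packM] := andP PM.
case: (boolP [exists B in M, (l <= #|A :&: B|)%N]) => [/exists_inP //|].
move=> /exists_inPn far; case/negP: AM.
(* Maximality under inclusion would force [A |: M = M], hence [A \in M]. *)
suff PA : P (A |: M) by rewrite -(maxM _ PA (subsetUr _ _)) setU11.
rewrite /P subUset sub1set AH MH; apply/partial_packingP => B C.
move=> /setU1P[->|BM] /setU1P[->|CM]; first by rewrite eqxx.
- by rewrite ltnNge far.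
- by rewrite setIC ltnNge far.
- exact: packM.
Qed.

(** Writing the sizes as [e.+2] and [e.+1] makes [S] nonempty, so that it has an edge [A] whose
    partner [B] in [M] can be added. *)
Lemma Gfree_setD (V : finType) (r l e : nat) (v : int) (H M : {set {set V}}) :
  uniform_hypergraph r H -> Gfree v e.+2 H -> M \subset H ->
  (forall A, A \in H :\: M -> exists2 B, B \in M & (l <= #|A :&: B|)%N) ->
  Gfree (v - r%:Z + l%:Z) e.+1 (H :\: M).
Proof.
move=> /forall_inP unif /forallP free MH near.
apply/forallP => S; apply/implyP => /andP[SHM /eqP cardS].
have /card_gt0P[A AS] : (0 < #|S|)%N by rewrite cardS.
have [B BM lAB] := near A (subsetP SHM A AS).
(* [S] avoids [M], so [B |: S] has exactly [e.+2] edges. *)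
have BS : B \notin S.
  by apply/negP => /(subsetP SHM); rewrite inE BM.
have BH := subsetP MH B BM.
have := free (B |: S).
rewrite subUset sub1set BH (subset_trans SHM (subsetDl _ _)).
rewrite cardsU1 BS cardS eqxx /=.
have -> : cover (B |: S) = B :|: cover S.
  by rewrite /cover big_setU1.
(* Since [A] lies in [cover S], [B] meets [cover S] in at least [l] vertices. *)
have := cardsUI B (cover S); rewrite (eqP (unif B BH)).
have : (#|A :&: B| <= #|B :&: cover S|)%N.
  by rewrite setIC subset_leq_card // setIS // (bigcup_max A).
lia.
Qed.

Theorem theorem20 (n r e : nat) (R : int) (he : (2 <= e)%N)
    (l : nat) (hl : (1 <= l <= r)%N) :
  (Tmax r n R e)%:R <=
    (Tmax r n (R - l%:Z) (e - 1)%N)%:R + 'C(n, l)%:R / 'C(r, l)%:R :> rat.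
Proof.
have [_ lr] := andP hl.
rewrite {1}/Tmax {1}/fmax; set T := Tmax _ _ _ _.
(* The bound holds at 0, the value of an empty maximum, and passes to maxima; it remains to treat a
   single [H]. *)
apply: (big_ind (fun k : nat => k%:R <= T%:R + 'C(n, l)%:R / 'C(r, l)%:R :> rat)).
- by rewrite addr_ge0 ?divr_ge0 ?ler0n.
- by move=> x y hx hy; rewrite /maxn; case: ifP.
move=> H /andP[unif free].
have [M /andP[MH packM] near] := partial_packing_maximal l H.
have unif_sub (K : {set {set 'I_n}}) : K \subset H -> uniform_hypergraph r K.
  by move=> KH; apply/forall_inP => A /(subsetP KH); apply/forall_inP: A.
have cardM := partial_packing_card (unif_sub M MH) packM.
rewrite card_ord in cardM.
have cardHM : (#|H :\: M| <= T)%N.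
  apply: (leq_bigmax_cond (F := fun K : {set {set 'I_n}} => #|K|)).
  rewrite unif_sub ?subsetDl //=.
  case: e he free {T} => [|[|e]] // _ free; rewrite subn1 /=.
  have := Gfree_setD unif free MH near.
  (* With [e.+2] for the original [e]: [e.+2 * r - R - r + l = e.+1 * r - (R - l)]. *)
  by congr (is_true (Gfree _ _ _)); lia.
rewrite -(cardsID M H) (setIidPr MH) natrD addrC lerD ?ler_nat //.
by rewrite ler_pdivlMr ?ltr0n ?bin_gt0 // -natrM ler_nat.
Qed.
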